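(* For every ternary signed-digit encoding $\alpha:\mathbb{N}\to\{\bar 1,0,1\}$, we have $\langle\!\langle \mathrm{neg}(\alpha)\rangle\!\rangle = -\langle\!\langle\alpha\rangle\!\rangle$ in the interval object $\mathbb{I}$; i.e. $\mathrm{neg}$ realises negation on the interval object.
   Context: Work in constructive type theory with function extensionality. An interval object is a set $\mathbb{I}$ with a binary operation $\oplus$, a map $M:\mathbb{I}^{\mathbb{N}}\to\mathbb{I}$ and points $-1,+1\in\mathbb{I}$ such that: $\oplus$ is idempotent, commutative, transpositional ($(a\oplus b)\oplus(c\oplus d)=(a\oplus c)\oplus(b\oplus d)$) and cancellative ($a\oplus c=b\oplus c\Rightarrow a=b$); $M(\alpha)=\alpha_0\oplus M(\mathrm{tail}\,\alpha)$ for all $\alpha$; for all $\alpha,\beta:\mathbb{N}\to\mathbb{I}$, if $\beta_i=\alpha_i\oplus\beta_{i+1}$ for all $i$ then $\beta_0=M(\alpha)$; and (universal property) for every set $B$ with $\oplus_B$, $M_B$, $s,t\in B$ satisfying all the preceding conditions, there is a unique $h:\mathbb{I}\to B$ with $h(-1)=s$, $h(+1)=t$ and $h(a\oplus b)=h(a)\oplus_B h(b)$. Fix such an interval object. $0:=-1\oplus+1$. Negation $-:\mathbb{I}\to\mathbb{I}$ is the unique map with $-(-1)=+1$, $-(+1)=-1$, $-(a\oplus b)=(-a)\oplus(-b)$. Ternary digits are $\{\bar1,0,1\}$ with $\langle\bar1\rangle=-1$, $\langle0\rangle=0$, $\langle1\rangle=+1$; for $\alpha:\mathbb{N}\to\{\bar1,0,1\}$,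 $\langle\!\langle\alpha\rangle\!\rangle:=M(n\mapsto\langle\alpha_n\rangle)$. $\mathrm{flip}$ swaps $\bar1$ and $1$ and fixes $0$, and $\mathrm{neg}(\alpha)_n:=\mathrm{flip}(\alpha_n)$. *)

(* Defs.v *)
From Stdlib Require Import EqdepFacts.
From mathcomp Require Import all_boot.

Set Implicit Arguments.
Unset Strict Implicit.
Unset Printing Implicit Defensive.

Definition tail (X : Type) (a : nat -> X) : nat -> X := fun n => a n.+1.

Record convex_body := ConvexBody {
  carrier :> Type;
  (* The carrier is a set in the sense of type theory: its identity types are
     propositions. *)
  carrier_set : UIP_ carrier;
  mid : carrier -> carrier -> carrier;
  midxx : idempotent_op mid;
  midC : commutative mid;
  midACA : interchange mid mid;
  mid_inj : left_injective mid;
  infmid : (nat -> carrier) -> carrier;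
  infmidE : forall a, infmid a = mid (a 0) (infmid (tail a));
  infmid_canonical : forall a b : nat -> carrier,
    (forall i, b i = mid (a i) (b i.+1)) -> b 0 = infmid a
}.

Arguments infmid {c} a.

Definition mid_morphism (A B : convex_body) (h : A -> B) :=
  {morph h : a b / mid a b >-> mid a b}.

Definition interval_morphism (A B : convex_body) (u v : A) (s t : B)
    (h : A -> B) :=
  [/\ h u = s, h v = t & mid_morphism h].

Record interval_object := IntervalObject {
  interval_body :> convex_body;
  neg1 : interval_body;
  pos1 : interval_body;
  (* Unique existence is constructive: the map is part of the data, as it is
     used below to define negation.  Uniqueness is equality of functions,
     which under function extensionality is pointwise equality. *)
  interval_universal : forall (B : convex_body) (s t : B),
    {h : interval_body -> B | unique (interval_morphism neg1 pos1 s t) h}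
}.

Arguments neg1 {i}.
Arguments pos1 {i}.
Arguments interval_universal : clear implicits.

Definition zero {I : interval_object} : I := mid neg1 pos1.

Definition opp {I : interval_object} : I -> I :=
  sval (interval_universal I I pos1 neg1).

Inductive digit := dneg | dzero | dpos.

Definition digit_val {I : interval_object} (d : digit) : I :=
  match d with dneg => neg1 | dzero => zero | dpos => pos1 end.

Definition ternary_val {I : interval_object} (alpha : nat -> digit) : I :=
  infmid (fun n => digit_val (alpha n)).

Definition flip (d : digit) : digit :=
  match d with dneg => dpos | dzero => dzero | dpos => dneg end.

Definition neg (alpha : nat -> digit) : nat -> digit :=
  fun n => flip (alpha n).

(* Main.v *)
From mathcomp Require Import all_boot.
Require Import Defs.

(** Identifies the head that [infmidE] splits off the [i]-th tail. *)
Lemma iter_tail0 (X : Type) (a : nat -> X) i : iter i (@tail X) a 0 = a i.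
Proof. by elim: i a => [|i IHi] a //; rewrite iterSr IHi. Qed.

(* The images under [h] of the values [infmid] takes on the successive tails
   of [a] satisfy the recurrence that characterises [infmid b].  Taking [b]
   only pointwise equal to [h \o a] avoids function extensionality. *)
Lemma mid_morphism_infmid {A B : convex_body} {h : A -> B}
    {a : nat -> A} {b : nat -> B} :
  mid_morphism h -> (forall n, b n = h (a n)) -> h (infmid a) = infmid b.
Proof.
move=> hM hab.
apply: (infmid_canonical (b := fun i => h (infmid (iter i (@tail A) a)))) => i.
by rewrite infmidE hM iter_tail0 -hab.
Qed.

(** Existence half of the universal property, for [I] with its endpoints swapped. *)
Lemma opp_morphism (I : interval_object) :
  @interval_morphism I I neg1 pos1 pos1 neg1 opp.
Proof. by case: (svalP (interval_universal I I pos1 neg1)). Qed.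

Lemma digit_val_flip (I : interval_object) (d : digit) :
  digit_val (flip d) = opp (digit_val d) :> I.
Proof.
have [oppN oppP oppM] := opp_morphism I.
(* The end digits close by [oppN] and [oppP]; at zero, [opp] swaps the two endpoints and [midC]
   swaps them back. *)
by case: d; rewrite //= /zero oppM oppN oppP midC.
Qed.

Theorem theorem5p56 (I : interval_object) (alpha : nat -> digit) :
  ternary_val (neg alpha) = opp (ternary_val alpha) :> I.
Proof.
have [_ _ oppM] := opp_morphism I.
(* The sequence [b] is the digit values of [neg alpha], which unfolds to [flip (alpha n)]. *)
by rewrite (mid_morphism_infmid oppM (fun n => digit_val_flip I (alpha n))).
Qed.
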